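(* Let $G=\{(p,f(p)):p\in M\}\subset M\times M'$ be the graph of the optimal transport map $f$, let $g$ be the Riemannian metric on $G$ induced by the $c$-divergence $\mathbf D$, and let $h$ be the pseudo-Riemannian metric on $M\times M'$ induced by the cost $c$ (all as defined in the context). Then for any $(p,f(p))\in G$, $$h\big|_{(T_{(p,f(p))}G)^2}=g .$$ That is, the information-geometric Riemannian metric $g$ is the restriction of $h$ to $G$.
   Context: Setting. $M,M'$ are $n$-dimensional smooth manifolds ($n\ge 2$), and $c:M\times M'\to\mathbb R$ is a smooth cost function. In local coordinates $\xi=(\xi^1,\dots,\xi^n)$ on $M$ and $\eta'=(\eta'^{\bar 1},\dots,\eta'^{\bar n})$ on $M'$ write $c_{i:\bar j}=\frac{\partial^2 c}{\partial\xi^i\partial\eta'^{\bar j}}$. The cost is assumed non-degenerate: the matrix $(c_{i:\bar j})$ is invertible at every point. Einstein summation is used. Optimal transport map. $\varphi:M\to\mathbb R$ is smooth and $c$-concave, i.e. there is $\psi:M'\to\mathbb R\cup\{-\infty\}$ with $\varphi(p)=\inf_{q'\in M'}(c(p,q')-\psi(q'))$ for all $p\in M$. For each $p\in M$ there is a unique $q'=:D^c\varphi(p)\in M'$ with $\varphi(p)+\psi(q')=c(p,q')$, and $f=D^c\varphi$ is a smooth diffeomorphism from $M$ onto its range $f(M)\subset M'$. $\psi$ is the $c$-transform of $\varphi$: $\psi(q)=\inf_{p\in M}(c(p,q)-\varphi(p))$, so $\psi(q)=c(f^{-1}(q),q)-\varphi(f^{-1}(q))$ for $q\in f(M)$. The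 graph $G=\{(p,f(p)):p\in M\}$ is an $n$-dimensional embedded submanifold of $M\times M'$. $c$-divergence. For $x=(p,q),\,x'=(p',q')\in G$, $\mathbf D[x:x']=c(p,q')-\varphi(p)-\psi(q')$. Metric $g$. Local coordinates $\xi$ on $M$ are used as (primal) coordinates on $G$ via $(p,f(p))\mapsto p$. Writing $\mathbf D=\mathbf D[\xi:\xi']$, $g_{ij}(\xi)=-\frac{\partial}{\partial\xi^i}\frac{\partial}{\partial\xi'^j}\mathbf D[\xi:\xi']\big|_{\xi'=\xi}$. Metric $h$. At $(\xi,\eta')$, for a tangent vector $v=a^i\frac{\partial}{\partial\xi^i}+b^{\bar i}\frac{\partial}{\partial\eta'^{\bar i}}$, $h(v,v)=-c_{i:\bar j}(\xi,\eta')\,a^ib^{\bar j}$; $h$ is extended to a symmetric bilinear form by polarization (so its matrix has zero diagonal blocks and off-diagonal blocks $-\tfrac12(c_{i:\bar j})$ and its transpose). *)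

(* Defs.v *)
From HB Require Import structures.
From mathcomp Require Import all_boot all_order all_algebra.
From mathcomp Require Import all_classical all_reals all_analysis.

Set Implicit Arguments.
Unset Strict Implicit.
Unset Printing Implicit Defensive.

Import Order.TTheory GRing.Theory Num.Theory.
Import numFieldNormedType.Exports.

Local Open Scope classical_set_scope.
Local Open Scope ring_scope.

(* C^k on A, for A open: differentiable k times, with continuous k-th order
   directional derivatives (in finite dimension, the usual notion). *)
Fixpoint Ck_on (R : realType) (V W : normedModType R) (k : nat)
    (A : set V) (f : V -> W) {struct k} : Prop :=
  if k is k'.+1 then
    (forall x, A x -> differentiable f x) /\
    (forall v, Ck_on k' A (fun x => 'D_v f x))
  else forall x, A x -> {for x, continuous f}.

Definition smooth_on (R : realType) (V W : normedModType R)
    (A : set V) (f : V -> W) : Prop := forall k, Ck_on k A f.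

(* [coord] and [icoord] are total functions; only their values on [dom] and on
   the image [cimage] of [dom] are meaningful. *)
Record chart (R : realType) (n : nat) (M : topologicalType) := Chart {
  dom : set M;
  coord : M -> 'rV[R]_n;
  icoord : 'rV[R]_n -> M;
  dom_open : open dom;
  coord_open : open (coord @` dom);
  coordK : forall p, dom p -> icoord (coord p) = p;
  coord_cont : forall p, dom p -> {for p, continuous coord};
  icoord_cont : forall x, (coord @` dom) x -> {for x, continuous icoord}
}.

Definition cimage (R : realType) (n : nat) (M : topologicalType)
  (k : chart R n M) : set 'rV[R]_n := coord k @` dom k.

Definition compatible (R : realType) (n : nat) (M : topologicalType)
    (k k' : chart R n M) : Prop :=
  smooth_on (coord k @` (dom k `&` dom k')) (coord k' \o icoord k) /\
  smooth_on (coord k' @` (dom k `&` dom k')) (coord k \o icoord k').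

(* The atlas is maximal, so its elements are all the local coordinate systems. *)
Record manifold (R : realType) (n : nat) := Manifold {
  space :> topologicalType;
  space_hausdorff : hausdorff_space space;
  space_second_countable : @second_countable space;
  atlas : set (chart R n space);
  atlas_cover : forall p : space, exists2 k, atlas k & dom k p;
  atlas_compatible : forall k k', atlas k -> atlas k' -> compatible k k';
  atlas_maximal : forall k,
    (forall k', atlas k' -> compatible k k') -> atlas k
}.

Arguments atlas {R n} m _.

Definition smooth_fun (R : realType) (n : nat) (M : manifold R n)
    (phi : M -> R) : Prop :=
  forall k, atlas M k -> smooth_on (cimage k) (phi \o icoord k).

Definition smooth_map_on (R : realType) (m n : nat) (M : manifold R m)
    (N : manifold R n) (U : set M) (f : M -> N) : Prop :=
  (forall p, U p -> {for p, continuous f}) /\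
  (forall k k', atlas M k -> atlas N k' ->
    smooth_on (coord k @` (dom k `&` U `&` f @^-1` dom k'))
              (coord k' \o f \o icoord k)).

(* [open (range f)] is the requirement that the range, of the same dimension as
   the target, is a submanifold of it. *)
Definition diffeo_onto_range (R : realType) (n : nat) (M M' : manifold R n)
    (f : M -> M') : Prop :=
  [/\ smooth_map_on setT f, open (range f) &
      exists2 finv : M' -> M, cancel f finv & smooth_map_on (range f) finv].

Definition cost_in_coords (R : realType) (n : nat) (M M' : manifold R n)
    (c : M -> M' -> R) (k : chart R n M) (k' : chart R n M')
    (xi eta : 'rV[R]_n) : R := c (icoord k xi) (icoord k' eta).

Definition smooth_cost (R : realType) (n : nat) (M M' : manifold R n)
    (c : M -> M' -> R) : Prop :=
  forall k k', atlas M k -> atlas M' k' ->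
    smooth_on (cimage k `*` cimage k')
      (fun z : 'rV[R]_n * 'rV[R]_n => cost_in_coords c k k' z.1 z.2).

Definition basis_vec (R : realType) (n : nat) (i : 'I_n) : 'rV[R]_n :=
  delta_mx ord0 i.

(* The matrix (c_{i:j}) of mixed second-order partial derivatives. *)
Definition cross_mx (R : realType) (n : nat) (M M' : manifold R n)
    (c : M -> M' -> R) (k : chart R n M) (k' : chart R n M')
    (xi eta : 'rV[R]_n) : 'M[R]_n :=
  \matrix_(i, j)
    'D_(basis_vec R i)
      (fun x => 'D_(basis_vec R j) (cost_in_coords c k k' x) eta) xi.

Definition nondegenerate_cost (R : realType) (n : nat) (M M' : manifold R n)
    (c : M -> M' -> R) : Prop :=
  forall k k', atlas M k -> atlas M' k' ->
  forall p q, dom k p -> dom k' q ->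
    cross_mx c k k' (coord k p) (coord k' q) \in unitmx.

Definition c_concave (R : realType) (X Y : Type) (c : X -> Y -> R)
    (phi : X -> R) : Prop :=
  exists psi : Y -> \bar R,
    (forall q, psi q != +oo%E) /\
    (forall p, (phi p)%:E = ereal_inf [set ((c p q)%:E - psi q)%E | q in setT]).

Definition c_transform (R : realType) (X Y : Type) (c : X -> Y -> R)
    (phi : X -> R) (q : Y) : \bar R :=
  ereal_inf [set (c p q - phi p)%:E | p in setT].

(* [f p] is the unique [q] with phi(p) + psi(q) = c(p,q), where psi is the
   c-transform of phi. *)
Definition is_c_gradient (R : realType) (X Y : Type) (c : X -> Y -> R)
    (phi : X -> R) (f : X -> Y) : Prop :=
  forall p q,
    ((phi p)%:E + c_transform c phi q)%E = (c p q)%:E <-> q = f p.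

Definition graph (X Y : Type) (f : X -> Y) : set (X * Y) :=
  [set (p, f p) | p in setT].

(* On the graph of the c-gradient of phi the c-transform is finite, so that
   [fine] does not change its value there. *)
Definition c_divergence (R : realType) (X Y : Type) (c : X -> Y -> R)
    (phi : X -> R) (x x' : X * Y) : R :=
  c x.1 x'.2 - phi x.1 - fine (c_transform c phi x'.2).

(* Inverse of the primal coordinate system (p, f p) |-> coord k p of the graph. *)
Definition graph_point (R : realType) (n : nat) (M M' : manifold R n)
    (f : M -> M') (k : chart R n M) (xi : 'rV[R]_n) : M * M' :=
  (icoord k xi, f (icoord k xi)).

Definition div_in_coords (R : realType) (n : nat) (M M' : manifold R n)
    (c : M -> M' -> R) (phi : M -> R) (f : M -> M') (k : chart R n M)
    (xi xi' : 'rV[R]_n) : R :=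
  c_divergence c phi (graph_point f k xi) (graph_point f k xi').

Definition g_mx (R : realType) (n : nat) (M M' : manifold R n)
    (c : M -> M' -> R) (phi : M -> R) (f : M -> M') (k : chart R n M)
    (xi : 'rV[R]_n) : 'M[R]_n :=
  \matrix_(i, j)
    - 'D_(basis_vec R i)
        (fun x => 'D_(basis_vec R j) (div_in_coords c phi f k x) xi) xi.

(* In product coordinates a tangent vector v of M x M' is the pair (v.1, v.2) of
   its components (a^i), (b^i).  A vector tangent to the graph has components
   v.1 in the primal coordinates of the graph. *)
Definition g_metric (R : realType) (n : nat) (M M' : manifold R n)
    (c : M -> M' -> R) (phi : M -> R) (f : M -> M') (k : chart R n M)
    (x : M * M') (v w : 'rV[R]_n * 'rV[R]_n) : R :=
  \sum_(i < n) \sum_(j < n)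
    g_mx c phi f k (coord k x.1) i j * v.1 ord0 i * w.1 ord0 j.

Definition h_quad (R : realType) (n : nat) (M M' : manifold R n)
    (c : M -> M' -> R) (k : chart R n M) (k' : chart R n M')
    (x : M * M') (v : 'rV[R]_n * 'rV[R]_n) : R :=
  - \sum_(i < n) \sum_(j < n)
      cross_mx c k k' (coord k x.1) (coord k' x.2) i j
        * v.1 ord0 i * v.2 ord0 j.

(* The symmetric bilinear form with diagonal [h_quad], by polarization. *)
Definition h_metric (R : realType) (n : nat) (M M' : manifold R n)
    (c : M -> M' -> R) (k : chart R n M) (k' : chart R n M')
    (x : M * M') (v w : 'rV[R]_n * 'rV[R]_n) : R :=
  (h_quad c k k' x (v + w) - h_quad c k k' x v - h_quad c k k' x w) / 2.

(* Tangent space at x of a subset S of M x M', in product coordinates: the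
   velocities at x of the smooth curves drawn on S. *)
Definition tangent_space (R : realType) (n : nat) (M M' : manifold R n)
    (S : set (M * M')) (k : chart R n M) (k' : chart R n M') (x : M * M') :
    set ('rV[R]_n * 'rV[R]_n) :=
  [set v | exists (gamma : R -> M * M') (e : R),
    let gamma_coords t := (coord k (gamma t).1, coord k' (gamma t).2) in
    [/\ 0 < e, gamma 0 = x,
        forall t, `|t| < e ->
          [/\ S (gamma t), dom k (gamma t).1 & dom k' (gamma t).2],
        smooth_on [set t : R | `|t| < e] gamma_coords &
        derive1 gamma_coords 0 = v]].

(* Main.v *)
(* Write C and F for c and f in coordinates, z0 = (xi0, F xi0), and
   T(a, b) = D_(a,0) D_(0,b) C (z0), so that h(v, v) = - T(v.1, v.2) and, the
   remaining terms of D[xi:xi'] being annihilated by the two derivatives,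
   g(v, w) = - T(v.1, DF w.1).  A vector tangent to the graph satisfies
   v.2 = DF v.1, so h = g amounts to the symmetry of T(a, DF b) in a and b.
   Since xi' |-> C(xi', F xi) - phi(xi') is minimal at xi, one has
   D_a phi (xi) = D_(a,0) C (xi, F xi); differentiating this in the direction b
   gives T(a, DF b) = D_b D_a phi - D_(b,0) D_(a,0) C, which is symmetric by
   Schwarz's theorem. *)
Require Import Defs.
From mathcomp Require Import all_boot all_order all_algebra.
From mathcomp Require Import all_classical all_reals all_analysis.
From mathcomp Require Import ring.

Import Defs.

Set Implicit Arguments.
Unset Strict Implicit.
Unset Printing Implicit Defensive.

Import Order.TTheory GRing.Theory Num.Theory.
Import numFieldNormedType.Exports.

Local Open Scope classical_set_scope.
Local Open Scope ring_scope.

(** * Symmetry of second directional derivatives *)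

Lemma is_derive_line (R : realType) (V W : normedModType R) (f : V -> W)
    (p d : V) (s : R) :
  differentiable f (s *: d + p) ->
  is_derive s 1 (fun t : R => f (t *: d + p)) ('D_d f (s *: d + p)).
Proof.
move=> df.
have dl : is_diff s (fun t : R => t *: d + p) ( *:%R^~ d).
  by apply: is_diff_eq; rewrite addr0.
have /differentiableP df' := df.
have dc := is_diff_comp dl df'.
apply: DeriveDef; first exact/diff_derivable.
by rewrite deriveE // diff_val /= scale1r deriveE.
Qed.

(** The second difference is the increment over [[0, t]] of [s |-> f (s u + t v + x) - f (s u + x)].
    The mean value theorem in [s] leaves a difference of values of ['D_u f], and a second use along
    [v] gives the other derivative. *)
Lemma second_difference_mvt (R : realType) (V : normedModType R) (f : V -> R)
    (x u v : V) (t : R) : 0 < t ->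
  (forall s s' : R, 0 <= s <= t -> 0 <= s' <= t ->
    differentiable f (s *: u + (s' *: v + x))) ->
  (forall s s' : R, 0 <= s <= t -> 0 <= s' <= t ->
    differentiable (fun y => 'D_u f y) (s *: u + (s' *: v + x))) ->
  exists s s' : R, [/\ 0 <= s <= t, 0 <= s' <= t &
    f (t *: u + (t *: v + x)) - f (t *: u + x) - (f (t *: v + x) - f x) =
    'D_v (fun y => 'D_u f y) (s *: u + (s' *: v + x)) * t ^+ 2].
Proof.
move=> t0 df ddf.
have tt : 0 <= t <= t by rewrite ltW/=.
have t0t : 0 <= (0 : R) <= t by rewrite lexx ltW.
have vx0 : x = 0 *: v + x by rewrite scale0r add0r.
pose phi := (fun s : R => f (s *: u + (t *: v + x))) - (fun s => f (s *: u + x)).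
have dphi s : 0 <= s <= t ->
    is_derive s 1 phi ('D_u f (s *: u + (t *: v + x)) - 'D_u f (s *: u + x)).
  move=> st; apply: is_deriveB; apply: is_derive_line; first exact: df.
  by rewrite vx0; exact: df.
have [|||s /[!in_itv]/= st] := @MVT_segment R phi
  (fun s => 'D_u f (s *: u + (t *: v + x)) - 'D_u f (s *: u + x)) 0 t.
- exact: ltW.
- by move=> s; rewrite in_itv/= => /andP[? ?]; apply: dphi; rewrite !ltW.
- by apply: derivable_within_continuous => s; rewrite in_itv/= => /dphi[].
rewrite subr0 {1 2}/phi !fctE/= !scale0r !add0r => phiE.
pose chi s' := 'D_u f (s' *: v + (s *: u + x)).
have dchi s' : 0 <= s' <= t -> is_derive s' 1 chi
    ('D_v (fun y => 'D_u f y) (s' *: v + (s *: u + x))).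
  move=> st'; apply: (@is_derive_line _ _ _ (fun y => 'D_u f y)).
  by rewrite addrCA; exact: ddf.
have [|||s' /[!in_itv]/= st' chiE] := @MVT_segment R chi
  (fun s' => 'D_v (fun y => 'D_u f y) (s' *: v + (s *: u + x))) 0 t.
- exact: ltW.
- by move=> s'; rewrite in_itv/= => /andP[? ?]; apply: dchi; rewrite !ltW.
- by apply: derivable_within_continuous => s'; rewrite in_itv/= => /dchi[].
exists s, s'; split => //.
transitivity (('D_u f (s *: u + (t *: v + x)) - 'D_u f (s *: u + x)) * t).
  by rewrite -phiE; ring.
move: chiE; rewrite /chi scale0r add0r subr0 (addrCA (t *: v)) (addrCA (s' *: v)).
by move=> ->; ring.
Qed.

(* The second difference of f is symmetric in u and v, so the mean value theorem
   makes D_v D_u f and D_u D_v f agree at points arbitrarily close to x. *)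
Lemma derive_symmetric (R : realType) (V : normedModType R) (A : set V)
    (f : V -> R) (x u v : V) : open A -> A x -> Ck_on 2 A f ->
  'D_u (fun y => 'D_v f y) x = 'D_v (fun y => 'D_u f y) x.
Proof.
move=> oA Ax [df ddf].
apply/eqP; rewrite -subr_eq0 -normr_le0; apply/ler_addgt0Pl => e e0.
rewrite addr0.
have e20 : 0 < e / 2 by rewrite divr_gt0.
have /(_ x Ax)/cvgrPdist_le/(_ _ e20) cu := (ddf v).2 u.
have /(_ x Ax)/cvgrPdist_le/(_ _ e20) cv := (ddf u).2 v.
have : nbhs x A by exact: open_nbhs_nbhs.
move=> /(filterI (filterI cu cv))/nbhs_ballP[r /= r0 rP].
(* This size keeps the whole parallelogram with sides [t u] and [t v] inside the ball of radius [r].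
   The summand 1 makes the denominator positive even if [u = v = 0], and the bound strict. *)
pose t := r / (`|u| + `|v| + 1).
have D0 : 0 < `|u| + `|v| + 1 by rewrite ltr_wpDl ?addr_ge0.
have t0 : 0 < t by rewrite divr_gt0.
have inb s s' : 0 <= s <= t -> 0 <= s' <= t -> ball x r (s *: u + (s' *: v + x)).
  move=> /andP[s0 st] /andP[s'0 st'].
  rewrite -ball_normE/= addrA opprD addrCA subrr addr0 normrN.
  apply: (le_lt_trans (ler_normD _ _)); rewrite !normrZ !ger0_norm//.
  apply: (@le_lt_trans _ _ (t * (`|u| + `|v|))).
    by rewrite mulrDr lerD// ler_wpM2r.
  by rewrite /t mulrAC ltr_pdivrMr// ltr_pM2l// ltrDl.
have inA s s' : 0 <= s <= t -> 0 <= s' <= t -> A (s *: u + (s' *: v + x)).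
  by move=> hs hs'; case: (rP _ (inb _ _ hs hs')).
have [|||s1 [s1' [h1 h1' E1]]] := @second_difference_mvt R V f x u v t.
- exact: t0.
- by move=> s s' hs hs'; apply: df; exact: inA.
- by move=> s s' hs hs'; apply: (ddf u).1; exact: inA.
have [|||s2 [s2' [h2 h2' E2]]] := @second_difference_mvt R V f x v u t.
- exact: t0.
- by move=> s s' hs hs'; apply: df; rewrite addrCA; exact: inA.
- by move=> s s' hs hs'; apply: (ddf v).1; rewrite addrCA; exact: inA.
have [[_ b1] _] := rP _ (inb _ _ h1 h1').
have [[b2 _] _] := rP _ (inb _ _ h2' h2).
(* Both sides times [t ^+ 2] are the same second difference. *)
have : 'D_v (fun y => 'D_u f y) (s1 *: u + (s1' *: v + x)) =
       'D_u (fun y => 'D_v f y) (s2 *: v + (s2' *: u + x)).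
  apply: (mulIf (lt0r_neq0 (exprn_gt0 2 t0))).
  by rewrite -E1 -E2 (addrCA (t *: u)); ring.
rewrite (addrCA (s2 *: v)) => E.
move: b1 b2; rewrite /= E => b1 b2.
rewrite [e]splitr; apply: (le_trans (ler_distD _ _ _)); apply: lerD b2 _.
by rewrite distrC.
Qed.

(** * Calculus of directional derivatives and critical points *)

Lemma derive_linearP (R : realType) (V W : normedModType R) (f : V -> W)
    (x u v : V) (a : R) : differentiable f x ->
  'D_(a *: u + v) f x = a *: 'D_u f x + 'D_v f x.
Proof. by move=> df; rewrite !deriveE// linearP. Qed.

Lemma derive_comp_diff (R : realType) (U V W : normedModType R) (f : U -> V)
    (g : V -> W) (x v : U) : differentiable f x -> differentiable g (f x) ->
  'D_v (g \o f) x = 'D_('D_v f x) g (f x).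
Proof.
move=> df dg; rewrite !deriveE//; last exact: differentiable_comp.
by rewrite diff_comp.
Qed.

Lemma derive_pairl (R : realType) (U V W : normedModType R) (f : U * V -> W)
    (x a : U) (y : V) : 'D_a (fun x => f (x, y)) x = 'D_(a, 0) f (x, y).
Proof.
rewrite /derive; do 2 f_equal; apply/funext => h /=.
have -> // : h *: (a, 0 : V) + (x, y) = (h *: a + x, y).
by congr pair; rewrite /= scaler0 add0r.
Qed.

Lemma derive_pairr (R : realType) (U V W : normedModType R) (f : U * V -> W)
    (x : U) (y b : V) : 'D_b (fun y => f (x, y)) y = 'D_(0, b) f (x, y).
Proof.
rewrite /derive; do 2 f_equal; apply/funext => h /=.
have -> // : h *: (0 : U, b) + (x, y) = (x, h *: b + y).
by congr pair; rewrite /= scaler0 add0r.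
Qed.

(** On the line [t |-> t d + x] this is the one-variable criterion for an interior minimum at 0. *)
Lemma derive_local_min (R : realType) (V : normedModType R) (f : V -> R)
    (x d : V) : (\forall y \near x, differentiable f y) ->
  (\forall y \near x, f x <= f y) -> 'D_d f x = 0.
Proof.
move=> df fmin.
have cl : (t *: d + x) @[t --> (0 : R)] --> x.
  have : {for (0 : R), continuous (fun t : R => t *: d + x)}.
    by apply: continuousD; [exact: scalel_continuous|exact: cst_continuous].
  by rewrite /prop_for/continuous_at scale0r add0r.
have : \forall t \near (0 : R), differentiable f (t *: d + x) /\ f x <= f (t *: d + x).
  exact: cl _ (filterI df fmin).
move=> /nbhs_ballP[r /= r0 rP].
have rI t : t \in `]- r, r[ -> ball (0 : R) r t.
  by rewrite in_itv/= -ball_normE/= sub0r normrN ltr_norml.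
have -> : 'D_d f x = 'D_1 (fun t : R => f (t *: d + x)) 0.
  have [df0 _] := rP 0 (ballxx _ r0).
  by case: (is_derive_line df0) => _; rewrite scale0r add0r => ->.
suff : is_derive (0 : R) 1 (fun t : R => f (t *: d + x)) 0 by case.
apply: (@derive1_at_min _ _ (- r) r).
- by rewrite ge0_cp// ltW.
- by move=> t /rI/rP[/is_derive_line[]].
- by rewrite in_itv/= oppr_lt0 r0.
- by move=> t /rI/rP[_]; rewrite scale0r add0r.
Qed.

(** The core of the argument, free of manifolds. Minimality is assumed at every [y] near [x], not
    only at [x], so that the first-order condition is an identity between functions and can be
    differentiated. *)
Lemma cross_derivative_symmetric (R : realType) (U V : normedModType R)
    (A : set (U * V)) (B : set U) (C : U * V -> R) (phi : U -> R) (F : U -> V)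
    (x : U) (a b : U) :
  open A -> A (x, F x) -> Ck_on 2 A C -> open B -> B x -> Ck_on 2 B phi ->
  differentiable F x ->
  (\forall y \near x, \forall y' \near y,
    C (y, F y) - phi y <= C (y', F y) - phi y') ->
  'D_(a, 0) (fun z => 'D_(0, 'D_b F x) C z) (x, F x) =
  'D_(b, 0) (fun z => 'D_(0, 'D_a F x) C z) (x, F x).
Proof.
move=> oA Ax C2 oB Bx phi2 dF fmin.
pose G y := (y, F y).
have dG : differentiable G x by apply: differentiable_pair => //.
have GE d : 'D_d G x = (d, 'D_d F x).
  by rewrite deriveE// diff_pair//= diff_val deriveE.
have nA : \forall y \near x, A (G y).
  by apply: (differentiable_continuous dG); exact: open_nbhs_nbhs.
have nB : \forall y \near x, B y by exact: open_nbhs_nbhs.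
have first_order d :
    \forall y \near x, 'D_d phi y = 'D_(d, 0) C (G y).
  near=> y.
  have Ay : A (G y) by near: y.
  have By : B y by near: y.
  have dC y' : A (y', F y) -> differentiable (fun y' => C (y', F y)) y'.
    by move=> /C2.1 ?; apply: (@differentiable_comp _ _ _ _ (fun y' => (y', F y)) C).
  have : 'D_d ((fun y' => C (y', F y)) - phi) y = 0.
    apply: derive_local_min; last by near: y.
    have : \forall y' \near y, A (y', F y) /\ B y'.
      apply: filterI; last exact: open_nbhs_nbhs.
      have : {for y, continuous (fun y' : U => (y', F y))}.
        by apply: cvg_pair; [exact: cvg_id|exact: cvg_cst].
      by apply; exact: open_nbhs_nbhs.
    apply: filterS => y' [/dC Ay' By'].
    by apply: differentiableB => //; exact: phi2.1.
  rewrite deriveB; [|exact/diff_derivable/dC|exact/diff_derivable/phi2.1].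
  by rewrite derive_pairl => /eqP; rewrite subr_eq0 => /eqP.
(* derivative of the first-order condition along y |-> (y, F y) *)
have hess d e : 'D_(d, 0) (fun z => 'D_(0, 'D_e F x) C z) (x, F x) =
    'D_e (fun y => 'D_d phi y) x - 'D_(e, 0) (fun z => 'D_(d, 0) C z) (x, F x).
  rewrite (near_eq_derive _ (first_order d)).
  have dCd := (C2.2 (d, 0)).1 _ Ax.
  rewrite (derive_comp_diff (f := G) (g := fun z => 'D_(d, 0) C z))// GE.
  (* Schwarz on the left-hand side, so that all the mixed terms are derivatives of the one function
     ['D_(d, 0) C]. *)
  rewrite (derive_symmetric _ _ oA Ax C2).
  have -> : (e, 'D_e F x) = 1 *: (e, 0) + (0, 'D_e F x).
    by rewrite scale1r; congr pair; rewrite /= ?addr0 ?add0r.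
  by rewrite (derive_linearP _ _ _ dCd) scale1r addrC addKr.
have Sphi := derive_symmetric b a oB Bx phi2.
have SC := derive_symmetric (b, 0) (a, 0) oA Ax C2.
apply: etrans (hess a b) (etrans _ (esym (hess b a))).
exact: (congr2 (fun s t => s - t) Sphi SC).
Unshelve. all: by end_near.
Qed.

Lemma derive_fst (R : realType) (U V W : normedModType R) (f : U -> V * W)
    (x v : U) : differentiable f x ->
  differentiable (fst \o f) x /\ 'D_v (fst \o f) x = ('D_v f x).1.
Proof.
move=> df.
have cf : continuous (fst : V * W -> V) by move=> z; exact: cvg_fst.
have dfst z : differentiable (fst : V * W -> V) z.
  exact: (linear_differentiable (f := fst)).
split; first exact: differentiable_comp.
by rewrite derive_comp_diff// deriveE// (diff_lin (f := fst)).
Qed.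

Lemma derive_snd (R : realType) (U V W : normedModType R) (f : U -> V * W)
    (x v : U) : differentiable f x -> 'D_v (snd \o f) x = ('D_v f x).2.
Proof.
move=> df.
have cf : continuous (snd : V * W -> W) by move=> z; exact: cvg_snd.
have dsnd z : differentiable (snd : V * W -> W) z.
  exact: (linear_differentiable (f := snd)).
by rewrite derive_comp_diff// deriveE// (diff_lin (f := snd)).
Qed.

(** * Bilinear forms: expansion in the standard basis and polarization *)

Lemma scalar_expand (R : realType) (n : nat) (T : 'rV[R]_n -> R)
    (v : 'rV[R]_n) : scalar T ->
  T v = \sum_(i < n) T (basis_vec R i) * v ord0 i.
Proof.
move=> lT.
have T0 : T 0 = 0.
  by have := lT (-1) 0 0; rewrite scaler0 addr0 mulN1r addNr.
have TD : {morph T : u w / u + w} by move=> u w; have := lT 1 u w; rewrite scale1r mul1r.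
rewrite {1}[v]row_sum_delta (big_morph T TD T0); apply: eq_bigr => i _.
by have := lT (v ord0 i) (basis_vec R i) 0; rewrite !addr0 T0 addr0 mulrC.
Qed.

Lemma bilinear_expand (R : realType) (n : nat)
    (T : 'rV[R]_n -> 'rV[R]_n -> R) (v w : 'rV[R]_n) :
  (forall u, scalar (T u)) -> (forall u, scalar (T^~ u)) ->
  \sum_(i < n) \sum_(j < n)
    T (basis_vec R i) (basis_vec R j) * v ord0 i * w ord0 j = T v w.
Proof.
move=> lr ll; rewrite (scalar_expand v (ll w)); apply: eq_bigr => i _.
rewrite (scalar_expand w (lr (basis_vec R i))) mulr_suml.
by apply: eq_bigr => j _; rewrite mulrAC.
Qed.

(** After expansion the diagonal terms cancel and the cross terms [T a b'] and [T a' b] remain; as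
    they agree, halving their sum gives [t]. *)
Lemma polarization (R : realType) (V W : lmodType R) (T : V -> W -> R)
    (a a' : V) (b b' : W) (t : R) :
  (forall u, scalar (T^~ u)) -> (forall u, scalar (T u)) ->
  T a b' = t -> T a' b = t ->
  (- T (a + a') (b + b') - - T a b - - T a' b') / 2 = - t.
Proof.
move=> ll lr ab' a'b.
have Dl u : T (a + a') u = T a u + T a' u.
  by have := ll u 1 a a'; rewrite scale1r mul1r.
have Dr u : T u (b + b') = T u b + T u b'.
  by have := lr u 1 b b'; rewrite scale1r mul1r.
by rewrite Dl !Dr ab' a'b; field.
Qed.

(** * The c-transform along the graph of the c-gradient *)

Section CGradient.
Context (R : realType) (X Y : Type) (c : X -> Y -> R) (phi : X -> R).
Context (f : X -> Y) (f_grad : is_c_gradient c phi f).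

(** The defining equation of the c-gradient has a real right-hand side, which excludes infinite
    values of the transform. Hence [fine] in the divergence is harmless on the graph. *)
Lemma c_transform_gradient (p : X) :
  c_transform c phi (f p) = (c p (f p) - phi p)%:E.
Proof.
have := (f_grad p (f p)).2 erefl.
case: c_transform => [r||] //; rewrite -EFinD => -[<-].
by rewrite addrC addKr.
Qed.

(** The infimum defining the c-transform at [f p] is attained at [p]. *)
Lemma c_gradient_min (p p' : X) :
  c p (f p) - phi p <= c p' (f p) - phi p'.
Proof.
rewrite -lee_fin -c_transform_gradient; apply: ereal_inf_lbound.
by exists p'.
Qed.

End CGradient.

(** * Expressions in charts: cost matrix, tangent vectors of the graph, metric [g] *)

Section Coordinates.
Context (R : realType) (n : nat) (M M' : manifold R n).
Context (c : M -> M' -> R) (phi : M -> R) (f : M -> M').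
Context (k : chart R n M) (k' : chart R n M').

Definition pair_cost (z : 'rV[R]_n * 'rV[R]_n) : R :=
  cost_in_coords c k k' z.1 z.2.

Definition map_in_coords : 'rV[R]_n -> 'rV[R]_n := coord k' \o f \o icoord k.

Lemma cross_mxE (xi eta : 'rV[R]_n) (i j : 'I_n) :
  cross_mx c k k' xi eta i j =
  'D_(basis_vec R i, 0) (fun z => 'D_(0, basis_vec R j) pair_cost z) (xi, eta).
Proof.
rewrite mxE -derive_pairl; do 2 f_equal; apply/funext => y.
by rewrite -derive_pairr.
Qed.

Lemma open_cimage_prod : open (cimage k `*` cimage k').
Proof.
rewrite openE => -[u w] [ku kw]; exists (cimage k, cimage k') => //.
by split; apply: open_nbhs_nbhs; split => //; exact: coord_open.
Qed.

Context (p : M) (kp : dom k p) (k'p : dom k' (f p)).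
Let xi0 := coord k p.

(** The neighbourhood on which [coord] and [icoord] of both charts really are inverse to each other
    along the graph. *)
Lemma near_coord (f_cont : {for p, continuous f}) :
  \forall xi \near xi0, cimage k xi /\ dom k' (f (icoord k xi)).
Proof.
have k0 : cimage k xi0 by exists p.
apply: filterI; first by apply: open_nbhs_nbhs; split; [exact: coord_open|].
have : {for xi0, continuous (f \o icoord k)}.
  apply: continuous_comp; first exact: icoord_cont.
  by rewrite coordK.
apply; rewrite /= coordK//; apply: open_nbhs_nbhs; split => //.
exact: dom_open.
Qed.

Lemma map_in_coords_center : map_in_coords xi0 = coord k' (f p).
Proof. by rewrite /map_in_coords/= coordK. Qed.

Lemma map_in_coords_differentiable : atlas M k -> atlas M' k' ->
  smooth_map_on setT f -> differentiable map_in_coords xi0.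
Proof.
by move=> hk hk' [_ /(_ k k' hk hk' 1%N)[df _]]; apply: df; exists p.
Qed.

(** A curve on the graph has second coordinate component equal to [map_in_coords] of the first; the
    chain rule at time 0 gives the relation between velocities. *)
Lemma tangent_graph (v : 'rV[R]_n * 'rV[R]_n) :
  differentiable map_in_coords xi0 ->
  tangent_space (graph f) k k' (p, f p) v ->
  v.2 = 'D_(v.1) map_in_coords xi0.
Proof.
move=> dF [gamma [e [e0 g0 gS gsm gd]]].
pose gc t := (coord k (gamma t).1, coord k' (gamma t).2); rewrite -/gc in gsm gd.
have dgc : differentiable gc (0 : R).
  by apply: (gsm 1%N).1; rewrite /= normr0.
have [d1 D1] := derive_fst (1 : R) dgc.
rewrite derive1E in gd; rewrite gd in D1.
have gc0 : (fst \o gc) 0 = xi0 by rewrite /gc/= g0.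
rewrite -gc0 in dF *.
rewrite -D1 -(derive_comp_diff (1 : R) d1 dF) -gd -(derive_snd (1 : R) dgc).
apply: near_eq_derive.
(* The curve is known to lie on the graph and in the chart domains only for these times, which
   suffices for a derivative at 0. *)
have : \forall t \near (0 : R), `|t| < e.
  by apply/nbhs_ballP; exists e => //= t; rewrite -ball_normE/= sub0r normrN.
apply: filterS => t /gS[[q _ qE] kq _].
by move: kq; rewrite /map_in_coords/gc/= -qE/= => kq; rewrite coordK.
Qed.

(** Only the cost term of the divergence depends on both arguments, so it alone survives the mixed
    derivative; the chain rule in the second argument brings in the derivative of
    [map_in_coords]. *)
Lemma g_mxE (i j : 'I_n) : is_c_gradient c phi f -> {for p, continuous f} ->
  Ck_on 2 (cimage k `*` cimage k') pair_cost ->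
  (forall xi, cimage k xi -> differentiable (phi \o icoord k) xi) ->
  differentiable map_in_coords xi0 ->
  g_mx c phi f k xi0 i j = - 'D_(basis_vec R i, 0)
    (fun z => 'D_(0, 'D_(basis_vec R j) map_in_coords xi0) pair_cost z)
    (xi0, map_in_coords xi0).
Proof.
move=> fg fc [dC ddC] dphi dF.
set F := map_in_coords in dF *.
have Fxi0 : cimage k' (F xi0).
  by rewrite /F map_in_coords_center//; exists (f p).
have kxi0 : cimage k xi0 by exists p.
(* This is the c-transform of [phi] at the image of [y], in coordinates. Writing it this way makes
   its differentiability evident. *)
pose G y := pair_cost (y, F y) - phi (icoord k y).
have dG : differentiable G xi0.
  apply: differentiableB; last exact: dphi.
  apply: (@differentiable_comp _ _ _ _ (fun y => (y, F y)) pair_cost).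
    by apply: differentiable_pair.
  exact: dC.
pose H z := 'D_(0, 'D_(basis_vec R j) F xi0) pair_cost z.
(* The inner derivative is needed for all [xi] near [xi0], since it is differentiated in [xi] next.
   The contribution of [G] does not depend on [xi]. *)
have inner : \forall xi \near xi0,
    'D_(basis_vec R j) (div_in_coords c phi f k xi) xi0 =
    ((fun xi => H (xi, F xi0)) - cst ('D_(basis_vec R j) G xi0)) xi.
  apply: filterS (near_coord fc) => xi [kxi _].
  have -> : 'D_(basis_vec R j) (div_in_coords c phi f k xi) xi0 =
      'D_(basis_vec R j) ((fun y => pair_cost (xi, y)) \o F
        - cst (phi (icoord k xi)) - G) xi0.
    apply: near_eq_derive; apply: filterS (near_coord fc) => y [_ ky].
    rewrite /div_in_coords /c_divergence /= c_transform_gradient// /G.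
    by rewrite !fctE/= /pair_cost /cost_in_coords /F /map_in_coords/= !coordK.
  have dCxi : differentiable (fun y => pair_cost (xi, y)) (F xi0).
    by apply: (@differentiable_comp _ _ _ _ (fun y => (xi, y)) pair_cost); last exact: dC.
  have dCF := differentiable_comp dF dCxi.
  rewrite deriveB; [|by apply/diff_derivable/differentiableB|exact/diff_derivable].
  rewrite deriveB; [|exact/diff_derivable|exact/diff_derivable].
  by rewrite derive_cst subr0 (derive_comp_diff _ dF dCxi) derive_pairr.
have dH : differentiable H (xi0, F xi0) by apply: (ddC _).1.
rewrite /g_mx mxE; apply: (congr1 -%R).
have innerE := near_eq_derive (basis_vec R i) inner.
apply: (etrans innerE); apply: (etrans _ (derive_pairl H _ _ _)).
rewrite deriveB ?derive_cst ?subr0//; apply: diff_derivable.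
exact: (@differentiable_comp _ _ _ _ (fun xi => (xi, F xi0)) H).
Qed.

End Coordinates.

Theorem theorem2 (R : realType) (n : nat) (hn : (2 <= n)%N)
  (M M' : manifold R n)
  (c : M -> M' -> R) (c_smooth : smooth_cost c)
  (c_nondeg : nondegenerate_cost c)
  (phi : M -> R) (phi_smooth : smooth_fun phi) (phi_conc : c_concave c phi)
  (f : M -> M') (f_grad : is_c_gradient c phi f)
  (f_diffeo : diffeo_onto_range f)
  (x : M * M') (Gx : graph f x)
  (k : chart R n M) (k' : chart R n M')
  (hk : atlas M k) (hk' : atlas M' k')
  (hx1 : dom k x.1) (hx2 : dom k' x.2)
  (v w : 'rV[R]_n * 'rV[R]_n)
  (hv : tangent_space (graph f) k k' x v)
  (hw : tangent_space (graph f) k k' x w) :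
  h_metric c k k' x v w = g_metric c phi f k x v w.
Proof.
case: Gx hx1 hx2 hv hw => p _ <- /= kp k'p hv hw.
have [f_smooth _ _] := f_diffeo.
have fc : {for p, continuous f} by exact: f_smooth.1.
have dF := map_in_coords_differentiable kp k'p hk hk' f_smooth.
have v2 := tangent_graph dF hv.
have w2 := tangent_graph dF hw.
have C2 : Ck_on 2 (cimage k `*` cimage k') (pair_cost c k k') by exact: c_smooth.
have oA : open (cimage k `*` cimage k') by exact: open_cimage_prod.
have nF := near_coord kp k'p fc.
have F0 := map_in_coords_center f k' kp.
set F := map_in_coords f k k' in dF v2 w2 F0.
set xi0 := coord k p in dF v2 w2 F0 nF.
have Az0 : (cimage k `*` cimage k') (xi0, F xi0).
  by split => /=; [exists p|rewrite F0; exists (f p)].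
pose T a b := 'D_(a, 0) (fun z => 'D_(0, b) (pair_cost c k k') z) (xi0, F xi0).
have Tl b : scalar (T^~ b).
  move=> s a a'; rewrite /T.
  have -> : (s *: a + a', 0 : 'rV[R]_n) = s *: (a, 0) + (a', 0).
    by congr pair; rewrite /= scaler0 addr0.
  exact: (derive_linearP _ _ _ ((C2.2 (0, b)).1 _ Az0)).
(* Here [b] is the direction of the inner derivative; Schwarz moves it outside, where linearity
   follows from differentiability at a single point. *)
have Tr a : scalar (T a).
  have TE b : T a b = 'D_(0, b) (fun z => 'D_(a, 0) (pair_cost c k k') z) (xi0, F xi0).
    exact: derive_symmetric oA Az0 C2.
  move=> s b b'; rewrite !TE.
  have -> : (0 : 'rV[R]_n, s *: b + b') = s *: (0, b) + (0, b').
    by congr pair; rewrite /= scaler0 addr0.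
  exact: (derive_linearP _ _ _ ((C2.2 (a, 0)).1 _ Az0)).
have Tsym a b : T a ('D_b F xi0) = T b ('D_a F xi0).
  apply: (@cross_derivative_symmetric _ _ _ _ (cimage k) _ (phi \o icoord k)
    F xi0 a b oA Az0 C2) => //.
  - exact: coord_open.
  - by exists p.
  - exact: phi_smooth.
  (* Only [y] must stay near [xi0]: the minimum over the first argument is global, so [y'] is
     arbitrary. *)
  - apply: filterS nF => y [_ ky]; apply: filterE => y'.
    rewrite /F /map_in_coords /pair_cost /cost_in_coords/= coordK//.
    exact: (c_gradient_min f_grad).
have hE u : h_quad c k k' (p, f p) u = - T u.1 u.2.
  rewrite /h_quad -(bilinear_expand _ _ Tr Tl); congr (- _).
  apply: eq_bigr => i _; apply: eq_bigr => j _.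
  by rewrite cross_mxE -F0.
have gE : g_metric c phi f k (p, f p) v w = - T v.1 ('D_(w.1) F xi0).
  have lr u : scalar (fun b => T u ('D_b F xi0)).
    by move=> s b b'; rewrite derive_linearP// Tr.
  rewrite -(bilinear_expand v.1 w.1 lr (fun u => Tl ('D_u F xi0))) -sumrN.
  apply: eq_bigr => i _; rewrite -sumrN; apply: eq_bigr => j _.
  by rewrite (g_mxE kp k'p i j f_grad fc C2 (phi_smooth k hk 1%N).1 dF) !mulNr.
rewrite gE /h_metric !hE /=.
(* The cross terms are [T v.1 w.2] and [T w.1 v.2]; tangency rewrites [w.2] and [v.2], and [Tsym]
   identifies the results. *)
apply: (polarization Tl Tr); first by rewrite w2.
by rewrite v2; exact: Tsym.
Qed.
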